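(* Let $1\le p,q\le\infty$, with conjugate exponents $p',q'$ ($\frac1p+\frac1{p'}=1$, $\frac1q+\frac1{q'}=1$), and let $X_0^{p,q}$ be the closure of the space of sequences with finite support in $X^{p,q}$. Then $$(X_0^{p,q})^*=X^{p',q'}$$ with the natural pairing $\langle f,g\rangle:=\sum_{I\in\mathcal{D}}f_Ig_I$. That is, each $g\in X^{p',q'}$ defines a bounded linear functional $f\mapsto\langle f,g\rangle$ on $X_0^{p,q}$, every bounded linear functional on $X_0^{p,q}$ is of this form for a unique $g\in X^{p',q'}$, and the norm of the functional equals $\|g\|_{X^{p',q'}}$.
   Context: $\mathcal{D}$ is the set of half-open dyadic subintervals of $[0,1)$ (including $[0,1)$), $\mathcal{G}_j$ ($j\ge0$) is the set of those of length $2^{-j}$, and $\mathcal{D}_i=\bigcup_{0\le j\le i}\mathcal{G}_j$. For $I\in\mathcal{D}$, $I_l,I_r$ are its left and right halves (its dyadic children). Sequences $g=\{g_I\}_{I\in\mathcal{D}}$ are sequences of numbers indexed by $\mathcal{D}$. For $1\le p,q\le\infty$ and $g$ supported on $\mathcal{D}_i$, the quantity $\|g\|_{X^{p,q}}$ is computed from bottom to top: put $N_I=|g_I|$ for $I\in\mathcal{G}_i$, and successively for $j=i-1,\dots,0$ and $I\in\mathcal{G}_j$ put $$N_I=\Big(\big(N_{I_r}^p+N_{I_l}^p\big)^{q/p}+|g_I|^q\Big)^{1/q},$$ with the convention that for $p=\infty$ or $q=\infty$ the corresponding $\ell^p$- or $\ell^q$-norm of a pair is replaced by the maximum; then $\|g\|_{X^{p,q}}:=N_{[0,1)}$.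 For an arbitrary sequence $g$, let $g_i$ be its truncation to $\mathcal{D}_i$ (equal to $g_I$ for $I\in\mathcal{D}_i$ and $0$ otherwise) and $\|g\|_{X^{p,q}}:=\sup_{i\ge0}\|g_i\|_{X^{p,q}}$. The space $X^{p,q}$ is the Banach space of all sequences $g$ with $\|g\|_{X^{p,q}}<\infty$. *)

(* Defs.v *)
From HB Require Import structures.
From mathcomp Require Import all_boot all_order all_algebra.
From mathcomp Require Import finmap complex.
From mathcomp Require Import all_classical all_reals all_analysis.
From mathcomp Require Export summability.
From mathcomp Require Import ring lra.

Set Implicit Arguments.
Unset Strict Implicit.
Unset Printing Implicit Defensive.

Import Order.TTheory GRing.Theory Num.Theory.
Import numFieldNormedType.Exports.

Local Open Scope classical_set_scope.
Local Open Scope ring_scope.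

(* The sequences may be real or complex: both scalar fields are covered. *)
Variant scalars := RealScalars | ComplexScalars.

Definition scalar_field (R : realType) (c : scalars) : numFieldType :=
  match c with RealScalars => R | ComplexScalars => R[i] end.

(* The norm [`|z|] of [R[i]] is [R[i]]-valued; here the modulus is real. *)
Definition modulus {R : realType} {c : scalars} : scalar_field R c -> R :=
  match c return scalar_field R c -> R with
  | RealScalars => fun x : R => `|x|
  | ComplexScalars => fun z : R[i] => Normc.normc z
  end.

(* [Tagged _ k] with [k : 'I_(2 ^ j)] stands for [k / 2 ^ j, (k + 1) / 2 ^ j[,
   see [dyadic_itv]; thus [tag I = j] means that I belongs to G_j. *)
Definition dyadic : Type := {j : nat & 'I_(2 ^ j)}.

Definition mk_dyadic (j k : nat) (h : (k < 2 ^ j)%N) : dyadic :=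
  Tagged (fun j => 'I_(2 ^ j)) (Ordinal h).

Lemma dyadic_root_subproof : (0 < 2 ^ 0)%N.
Proof. by []. Qed.

Lemma dyadic_left_subproof (I : dyadic) :
  ((tagged I : nat).*2 < 2 ^ (tag I).+1)%N.
Proof. by rewrite expnS mul2n ltn_double. Qed.

Lemma dyadic_right_subproof (I : dyadic) :
  ((tagged I : nat).*2.+1 < 2 ^ (tag I).+1)%N.
Proof. by rewrite expnS mul2n ltn_Sdouble. Qed.

Definition dyadic_root : dyadic := mk_dyadic dyadic_root_subproof.
Definition dyadic_left (I : dyadic) : dyadic :=
  mk_dyadic (dyadic_left_subproof I).
Definition dyadic_right (I : dyadic) : dyadic :=
  mk_dyadic (dyadic_right_subproof I).

Definition dyadic_itv (R : realType) (I : dyadic) : interval R :=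
  `[(tagged I : nat)%:R / 2 ^+ tag I, (tagged I : nat).+1%:R / 2 ^+ tag I[.

Lemma dyadic_itv_root (R : realType) : dyadic_itv R dyadic_root = `[0, 1[.
Proof. by rewrite /dyadic_itv /= mul0r expr0 divr1. Qed.

Lemma dyadic_itv_left (R : realType) (I : dyadic) (a b : R) :
  dyadic_itv R I = `[a, b[ -> dyadic_itv R (dyadic_left I) = `[a, (a + b) / 2[.
Proof.
have h : (2 : R) ^+ tag I != 0 by rewrite expf_neq0.
case=> <- <-; rewrite /dyadic_itv /= exprS -muln2 -!natr1 natrM.
by congr (Interval (BLeft _) (BLeft _)); field.
Qed.

Lemma dyadic_itv_right (R : realType) (I : dyadic) (a b : R) :
  dyadic_itv R I = `[a, b[ -> dyadic_itv R (dyadic_right I) = `[(a + b) / 2, b[.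
Proof.
have h : (2 : R) ^+ tag I != 0 by rewrite expf_neq0.
case=> <- <-; rewrite /dyadic_itv /= exprS -muln2 -!natr1 natrM.
by congr (Interval (BLeft _) (BLeft _)); field.
Qed.

(* The l^p norm of a pair of nonnegative numbers, 1 <= p <= +oo. *)
Definition lpair {R : realType} (p : \bar R) (a b : R) : R :=
  if p is r%:E then (a `^ r + b `^ r) `^ r^-1 else Num.max a b.

(* The quantity N_I when n levels of the tree are kept below I. For finite
   exponents the nested norm is
   ((N_{I_r}^p + N_{I_l}^p)^{q/p} + |g_I|^q)^{1/q}. *)
Fixpoint node_norm {R : realType} {c : scalars} (p q : \bar R)
    (g : dyadic -> scalar_field R c) (n : nat) (I : dyadic) : R :=
  if n is m.+1 then
    lpair q (lpair p (node_norm p q g m (dyadic_right I))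
                     (node_norm p q g m (dyadic_left I)))
            (modulus (g I))
  else modulus (g I).

Definition truncation {R : realType} {c : scalars} (i : nat)
    (g : dyadic -> scalar_field R c) : dyadic -> scalar_field R c :=
  fun I => if (tag I <= i)%N then g I else 0.

Definition Xnorm {R : realType} {c : scalars} (p q : \bar R)
    (g : dyadic -> scalar_field R c) : \bar R :=
  ereal_sup [set (node_norm p q (truncation i g) i dyadic_root)%:E
            | i in [set: nat]].

Definition Xspace {R : realType} {c : scalars} (p q : \bar R) :
    set (dyadic -> scalar_field R c) :=
  [set g | (Xnorm p q g < +oo)%E].

Definition finite_support {R : realType} {c : scalars} :
    set (dyadic -> scalar_field R c) :=
  [set h | finite_set [set I | h I != 0]].

(* The closure of the finitely supported sequences in X^{p,q}. *)
Definition X0space {R : realType} {c : scalars} (p q : \bar R) :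
    set (dyadic -> scalar_field R c) :=
  [set f | Xspace p q f /\
    forall e : R, 0 < e ->
      exists2 h : dyadic -> scalar_field R c, finite_support h & (Xnorm p q (f - h)%R < e%:E)%E].

(* A functional on X_0^{p,q} is given by a function on all sequences, of which
   only the values on X_0^{p,q} matter. *)
Definition bounded_functional {R : realType} {c : scalars} (p q : \bar R)
    (phi : (dyadic -> scalar_field R c) -> scalar_field R c) : Prop :=
  (forall (a : scalar_field R c) (f h : dyadic -> scalar_field R c),
     X0space p q f -> X0space p q h ->
     phi (a *: f + h) = a * phi f + phi h) /\
  (exists M : R, forall f, X0space p q f ->
     ((modulus (phi f))%:E <= M%:E * Xnorm p q f)%E).

Definition functional_norm {R : realType} {c : scalars} (p q : \bar R)
    (phi : (dyadic -> scalar_field R c) -> scalar_field R c) : \bar R :=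
  ereal_sup [set (modulus (phi f))%:E
            | f in [set f | X0space p q f /\ (Xnorm p q f <= 1)%E]].

(* The sum over the countable set of dyadic intervals is unordered: it is the
   limit of the finite partial sums along the filter [totally]. *)
Definition pairing_cvg {R : realType} {c : scalars}
    (f g : dyadic -> scalar_field R c) : Prop :=
  cvg (partial_sum (fun I => f I * g I) @ totally).

Definition pairing {R : realType} {c : scalars}
    (f g : dyadic -> scalar_field R c) : scalar_field R c :=
  summability.sum (fun I => f I * g I).

(* Main.v *)
Require Import Defs.
From HB Require Import structures.
From mathcomp Require Import all_boot all_order all_algebra.
From mathcomp Require Import finmap complex.
From mathcomp Require Import all_classical all_reals all_analysis.
From mathcomp Require Import lra.

(** The norm of X^{p,q} is an iteration, along the dyadic tree, of l^p and l^q
    norms of pairs of nonnegative numbers.  For pairs, duality is elementary: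
    Hoelder's inequality [lpair_hoelder] holds, and it is sharp
    ([lpair_dual_attained]).  Both facts propagate up the tree.  Applying them
    twice at each node, first to the two children and then to the pair formed
    by the children and the node itself, shows by induction on the depth that
    the finite sections of f and g satisfy
    sum |f_J g_J| <= N^{p,q}(f) N^{p',q'}(g) ([node_norm_hoelder]), and that for
    each g some f of norm at most 1 supported on the section gives
    sum f_J g_J = N^{p',q'}(g) ([node_norm_dual_attained]).

    The first fact bounds all finite sums of |f_J g_J|, so the unordered series
    of the pairing converges (completeness of the scalars is used through
    [cvg_absolute_sum]) and defines a functional of norm at most that of g; the
    second, with test sequences f of finite support, gives equality.

    Conversely a bounded functional phi is represented by its values
    g_I = phi(e_I) on the unit sequences.  On finitely supported f,
    phi f = <f, g> by linearity; testing on the norming sequences of the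
    sections of g bounds the norm of g by that of phi, and phi = <., g> on the
    closure by density, both sides being bounded on it. *)

Set Implicit Arguments.
Unset Strict Implicit.
Unset Printing Implicit Defensive.

Import Order.TTheory GRing.Theory Num.Theory.
Import numFieldNormedType.Exports.

Local Open Scope classical_set_scope.
Local Open Scope ring_scope.

(** * Duality for the norms of pairs *)

Section PairNorm.
Context {R : realType}.
Implicit Types (p q : \bar R) (a b c d t : R).

(** The three cases of the equation 1/p + 1/q = 1, in the form consumed by
    case analysis: in each of them [lpair] takes an explicit form. *)
Variant conjugate_exponents : \bar R -> \bar R -> Prop :=
  | Conjugate1y : conjugate_exponents 1%E +oo%E
  | Conjugatey1 : conjugate_exponents +oo%E 1%E
  | ConjugateFin (r s : R) : 1 < r -> 1 < s -> r^-1 + s^-1 = 1 ->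
      conjugate_exponents r%:E s%:E.

Lemma conjugate_exponentsP p q :
  (1 <= p)%E -> (p^-1 + q^-1 = 1)%E -> conjugate_exponents p q.
Proof.
case: p => [r| |]//; last first.
  move=> _; rewrite invey add0e => /eqP; rewrite inve_eq1 => /eqP ->.
  exact: Conjugatey1.
rewrite lee_fin => r1.
have r0 : 0 < r by rewrite (lt_le_trans ltr01).
rewrite inver gt_eqF//; case: q => [s| |].
- rewrite inver; case: eqP => // /eqP s0.
  rewrite -EFinD => -[rs].
  move: r1; rewrite le_eqVlt => /predU1P[r1|r1].
    move: rs; rewrite -r1 invr1 => /(canRL (addKr _)).
    by rewrite addNr => /eqP; rewrite invr_eq0 (negbTE s0).
  have si : 0 < s^-1 < 1.
    have := invf_lt1 r0; rewrite r1 => ri.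
    have : 0 < r^-1 by rewrite invr_gt0.
    by move=> r'0; apply/andP; split; lra.
  apply: ConjugateFin => //.
  have /andP[s'0 s1] := si; rewrite invr_gt0 in s'0.
  by rewrite -(invf_lt1 s'0).
- rewrite invey adde0 => -[/eqP]; rewrite invr_eq1 => /eqP ->.
  exact: Conjugate1y.
- by rewrite inveNy.
Qed.

Lemma conjugate_exponents_ge1 p q : conjugate_exponents p q -> (1 <= p)%E.
Proof. by case=> [||r s r1 _ _]; rewrite ?lexx ?leey// lee_fin ltW. Qed.

Lemma lpair_ge0 p a b : 0 <= a -> 0 <= lpair p a b.
Proof. by case: p => [r| |] a0; rewrite /lpair ?powR_ge0// le_max a0. Qed.

Lemma lpair_le p a b c d : (1 <= p)%E -> 0 <= a -> 0 <= b ->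
  a <= c -> b <= d -> lpair p a b <= lpair p c d.
Proof.
case: p => [r| |] p1 a0 b0 ac bd; rewrite /lpair; first last.
- by rewrite ge_max !le_max ac bd orbT.
- by rewrite ge_max !le_max ac bd orbT.
have r0 : 0 <= r by rewrite (le_trans ler01).
have c0 := le_trans a0 ac; have d0 := le_trans b0 bd.
apply: ge0_ler_powR; rewrite ?invr_ge0 ?nnegrE ?addr_ge0 ?powR_ge0//.
by apply: lerD; apply: ge0_ler_powR; rewrite ?nnegrE.
Qed.

Lemma lpairZ p t a b : (1 <= p)%E -> 0 <= t -> 0 <= a -> 0 <= b ->
  lpair p (t * a) (t * b) = t * lpair p a b.
Proof.
case: p => [r| |] p1 t0 a0 b0; rewrite /lpair ?maxr_pMr//.
have r0 : r != 0 by rewrite gt_eqF// (lt_le_trans ltr01).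
rewrite !powRM// -mulrDr powRM ?powR_ge0 ?addr_ge0 ?powR_ge0//.
by rewrite -powRrM divff// powRr1.
Qed.

Lemma lpair0l p b : (1 <= p)%E -> 0 <= b -> lpair p 0 b = b.
Proof.
case: p => [r| |] p1 b0; rewrite /lpair; [|exact/max_idPr|exact/max_idPr].
have r0 : r != 0 by rewrite gt_eqF// (lt_le_trans ltr01).
by rewrite powR0// add0r -powRrM divff// powRr1.
Qed.

Lemma lpair1 a b : 0 <= a -> 0 <= b -> lpair 1%E a b = a + b.
Proof. by move=> a0 b0; rewrite /lpair invr1 !powRr1// addr_ge0. Qed.

Lemma lpair_hoelder p q a b c d : conjugate_exponents p q ->
  0 <= a -> 0 <= b -> 0 <= c -> 0 <= d ->
  a * c + b * d <= lpair p a b * lpair q c d.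
Proof.
move=> pq a0 b0 c0 d0; case: pq => [||r s r1 s1 rs].
- rewrite lpair1// mulrDl.
  by apply: lerD; rewrite ler_wpM2l// /lpair le_max lexx ?orbT.
- rewrite lpair1// mulrDr.
  by apply: lerD; rewrite ler_wpM2r// /lpair le_max lexx ?orbT.
- by apply: hoelder2; rewrite // (lt_trans ltr01).
Qed.

(** Sharpness of Hoelder's inequality: for finite exponents the extremal pair is
    proportional to (c^{s-1}, d^{s-1}); for p = 1 it selects the larger entry,
    and for p = oo it is (1, 1). *)
Lemma lpair_dual_attained p q c d : conjugate_exponents p q ->
  0 <= c -> 0 <= d ->
  exists a b, [/\ 0 <= a, 0 <= b, lpair p a b <= 1 &
                  a * c + b * d = lpair q c d].
Proof.
move=> pq c0 d0; case: pq => [||r s r1 s1 rs].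
- have [cd|/ltW dc] := leP c d.
    exists 0, 1; rewrite lpair1// add0r mul0r mul1r add0r; split=> //.
    exact/esym/max_idPr.
  exists 1, 0; rewrite lpair1// addr0 mul0r mul1r addr0; split=> //.
  exact/esym/max_idPl.
- by exists 1, 1; rewrite lpair1// /lpair maxxx !mul1r; split.
have r0 : 0 < r by rewrite (lt_trans ltr01).
have s0 : 0 < s by rewrite (lt_trans ltr01).
set N := lpair s%:E c d.
have [N0|N0] := eqVneq N 0.
  exists 0, 0; split=> //; last by rewrite !mul0r addr0 -/N N0.
  by rewrite lpair0l ?lee_fin// ltW.
have Npos : 0 < N by rewrite lt_neqAle eq_sym N0 lpair_ge0.
pose u := N^-1 * c; pose v := N^-1 * d.
have u0 : 0 <= u by rewrite mulr_ge0// invr_ge0 ltW.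
have v0 : 0 <= v by rewrite mulr_ge0// invr_ge0 ltW.
have uv : u `^ s + v `^ s = 1.
  have : lpair s%:E u v = 1.
    have s1' : (1 <= s%:E)%E by rewrite lee_fin ltW.
    have N'0 : 0 <= N^-1 by rewrite invr_ge0 ltW.
    by rewrite lpairZ// -/N mulVf.
  rewrite /lpair => /(congr1 (fun x => x `^ s)).
  by rewrite -powRrM mulVf ?gt_eqF// powRr1 ?powR1// addr_ge0 ?powR_ge0.
(* Since s / r = s - 1, the r-th powers of these weights are u^s and v^s, and
   their products with u and v are u^s and v^s again. *)
exists (u `^ (s / r)), (v `^ (s / r)); split; rewrite ?powR_ge0//.
  by rewrite /lpair -!powRrM divfK ?gt_eqF// uv powR1.
have sr : s / r + 1 = s.
  have /(congr1 (fun x => s * x)) := rs.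
  by rewrite mulrDr divff ?gt_eqF// mulr1.
have srN : s / r + 1 != 0 by rewrite sr gt_eqF.
have E w : 0 <= w -> w `^ (s / r) * w = w `^ s.
  by move=> w0; rewrite -{2}(powRr1 w0) -powRD ?(negbTE srN)// sr.
have -> : c = N * u by rewrite mulrA divff// mul1r.
have -> : d = N * v by rewrite mulrA divff// mul1r.
by rewrite mulrCA (mulrCA _ N) E// E// -mulrDr uv mulr1.
Qed.

End PairNorm.

(** * Real and complex scalars *)

Section Scalars.
Context {R : realType} {c : scalars}.
Local Notation K := (scalar_field R c).
Implicit Types (x y z : K).

(** The norm of a numeric field takes values in the field itself; this
    embedding compares it with the real-valued [modulus], so that the arguments
    below need not distinguish the two scalar fields. *)
Definition scalar_of_real : R -> K :=
  match c return R -> scalar_field R c with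
  | RealScalars => fun r => r
  | ComplexScalars => fun r => (r%:C)%C
  end.

Lemma scalar_of_realD r s :
  scalar_of_real (r + s) = scalar_of_real r + scalar_of_real s.
Proof. by rewrite /scalar_of_real; case: c => //; rewrite rmorphD. Qed.

Lemma scalar_of_realM r s :
  scalar_of_real (r * s) = scalar_of_real r * scalar_of_real s.
Proof. by rewrite /scalar_of_real; case: c => //; rewrite rmorphM. Qed.

Lemma scalar_of_real0 : scalar_of_real 0 = 0.
Proof. by rewrite /scalar_of_real; case: c. Qed.

Lemma scalar_of_real_le r s :
  (scalar_of_real r <= scalar_of_real s) = (r <= s).
Proof. by rewrite /scalar_of_real; case: c => //; rewrite lecR. Qed.

Lemma scalar_of_real_sum (I : Type) (s : seq I) (F : I -> R) :
  scalar_of_real (\sum_(i <- s) F i) = \sum_(i <- s) scalar_of_real (F i).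
Proof. exact: (big_morph _ scalar_of_realD scalar_of_real0). Qed.

Lemma norm_modulus z : `|z| = scalar_of_real (modulus z).
Proof. by rewrite /scalar_of_real /modulus; case: c z. Qed.

(** A positive complex number is real, hence convergence in the scalar field can
    be tested with real radii only. *)
Lemma pos_scalar_of_real z :
  0 < z -> exists2 r : R, 0 < r & z = scalar_of_real r.
Proof.
rewrite /scalar_of_real; case: c z => [z z0|z z0]; first by exists z.
exists (complex.Re z); last by rewrite RRe_real// gtr0_real.
by move: z0; rewrite ltcE => /andP[].
Qed.

Lemma modulus_scalar_of_real r : modulus (scalar_of_real r) = `|r|.
Proof.
rewrite /scalar_of_real /modulus; case: c => //=.
by rewrite expr0n addr0 sqrtr_sqr.
Qed.

Lemma modulus_ge0 z : 0 <= modulus z.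
Proof.
by rewrite -scalar_of_real_le scalar_of_real0 -norm_modulus.
Qed.

Lemma scalar_of_real_inj : injective scalar_of_real.
Proof.
by move=> r s /eqP; rewrite eq_le !scalar_of_real_le -eq_le => /eqP.
Qed.

Lemma modulusM x y : modulus (x * y) = modulus x * modulus y.
Proof.
by apply: scalar_of_real_inj; rewrite scalar_of_realM -!norm_modulus normrM.
Qed.

Lemma modulus0 : modulus (0 : K) = 0.
Proof.
by apply: scalar_of_real_inj; rewrite -norm_modulus normr0 scalar_of_real0.
Qed.

Lemma modulus1 : modulus (1 : K) = 1.
Proof.
apply: scalar_of_real_inj; rewrite -norm_modulus normr1.
by rewrite /scalar_of_real; case: c.
Qed.

Lemma modulusN x : modulus (- x) = modulus x.
Proof. by apply: scalar_of_real_inj; rewrite -!norm_modulus normrN. Qed.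

Lemma modulusD x y : modulus (x + y) <= modulus x + modulus y.
Proof.
by rewrite -scalar_of_real_le scalar_of_realD -!norm_modulus ler_normD.
Qed.

Lemma modulus_eq0 x : modulus x = 0 -> x = 0.
Proof.
by move=> x0; apply/normr0_eq0; rewrite norm_modulus x0 scalar_of_real0.
Qed.

Lemma modulus_sum (I : Type) (s : seq I) (F : I -> K) :
  modulus (\sum_(i <- s) F i) <= \sum_(i <- s) modulus (F i).
Proof.
elim: s => [|i s IHs]; first by rewrite !big_nil modulus0.
by rewrite !big_cons (le_trans (modulusD _ _))// lerD2l.
Qed.

Lemma exists_phase z :
  exists2 u : K, modulus u <= 1 & u * z = scalar_of_real (modulus z).
Proof.
have [->|z0] := eqVneq z 0.
  by exists 0; rewrite modulus0 ?scalar_of_real0 ?mulr0.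
exists (`|z| / z); last by rewrite divfK// norm_modulus.
rewrite -scalar_of_real_le -norm_modulus normf_div normr_id divff ?normr_eq0//.
by rewrite -modulus1 -norm_modulus normr1.
Qed.

(** Positive and negative parts of the real and imaginary parts; [w] is the
    imaginary unit, or 0 over the reals.  This reduces absolute convergence in
    either field to the monotone convergence of nonnegative real sums. *)
Lemma scalar_decomposition : exists (w : K) (P1 N1 P2 N2 : K -> R),
  forall z, [/\ 0 <= P1 z <= modulus z, 0 <= N1 z <= modulus z,
    0 <= P2 z <= modulus z, 0 <= N2 z <= modulus z &
    z = scalar_of_real (P1 z) - scalar_of_real (N1 z)
        + w * (scalar_of_real (P2 z) - scalar_of_real (N2 z))].
Proof.
pose P (x : R) := Num.max x 0; pose N (x : R) := Num.max (- x) 0.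
have PN (x : R) : x = P x - N x.
  rewrite /P /N; have [x0|/ltW x0] := leP x 0.
    by rewrite max_l ?oppr_ge0// sub0r opprK.
  by rewrite max_r ?oppr_le0// subr0.
have Pb (x : R) : 0 <= P x <= `|x|.
  by rewrite /P le_max lexx orbT ge_max ler_norm normr_ge0.
have Nb (x : R) : 0 <= N x <= `|x|.
  by rewrite /N le_max lexx orbT ge_max -normrN ler_norm normr_ge0.
rewrite /scalar_of_real /modulus; case: c.
  exists 0, P, N, (fun _ => 0), (fun _ => 0) => z.
  by rewrite mul0r addr0 -PN normr_ge0 lexx; split.
have Reb (z : R[i]) : `|complex.Re z| <= Normc.normc z.
  by have := normc_ge_Re z; rewrite lecR.
have Imb (z : R[i]) : `|complex.Im z| <= Normc.normc z.
  case: z => a b /=; rewrite -sqrtr_sqr ler_wsqrtr// lerDr sqr_ge0//.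
exists 'i%C,
  (fun z : R[i] => P (complex.Re z)), (fun z : R[i] => N (complex.Re z)),
  (fun z : R[i] => P (complex.Im z)), (fun z : R[i] => N (complex.Im z)) => z.
split.
- by have /andP[-> /le_trans->] := Pb (complex.Re z).
- by have /andP[-> /le_trans->] := Nb (complex.Re z).
- by have /andP[-> /le_trans->] := Pb (complex.Im z).
- by have /andP[-> /le_trans->] := Nb (complex.Im z).
- by rewrite -!rmorphB -!PN -complexE.
Qed.

End Scalars.

(** * Absolutely convergent unordered sums *)

#[local] Existing Instance totally_filter.

Section UnorderedSums.
Context {R : realType} {c : scalars} {I : choiceType}.
Local Notation K := (scalar_field R c).
Implicit Types (x y : I -> K) (A B : {fset I}).

Lemma partial_sumE x A : partial_sum x A = \sum_(i <- A) x i.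
Proof. by rewrite /partial_sum big_seq_fsetE. Qed.

Lemma cvg_partial_sumP x (l : K) :
  partial_sum x @ totally --> l <->
  forall e : R, 0 < e -> exists A, forall B, (A `<=` B)%fset ->
    modulus (l - \sum_(i <- B) x i) <= e.
Proof.
split=> [/cvgrPdist_le xl e e0|xl].
  have e'0 : 0 < scalar_of_real e :> K.
    by rewrite lt_neqAle -scalar_of_real0 scalar_of_real_le ltW// andbT
      (inj_eq scalar_of_real_inj) lt_eqF.
  have [A _ AB] := xl _ e'0; exists A => B /AB /=.
  by rewrite norm_modulus scalar_of_real_le partial_sumE.
apply/cvgrPdist_le => _ /pos_scalar_of_real[e e0 ->].
have [A AB] := xl _ e0; exists A => // B /AB /=.
by rewrite norm_modulus scalar_of_real_le partial_sumE.
Qed.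

Lemma partial_sumD x y :
  partial_sum (fun i => x i + y i) = partial_sum x + partial_sum y.
Proof. by apply/funext => A; rewrite fctE !partial_sumE big_split. Qed.

Lemma partial_sumZ (a : K) x :
  partial_sum (fun i => a * x i) = (fun A => a * partial_sum x A).
Proof. by apply/funext => A; rewrite !partial_sumE mulr_sumr. Qed.

Lemma ler_sum_fset (a : I -> R) A B : (forall i, 0 <= a i) ->
  (A `<=` B)%fset -> \sum_(i <- A) a i <= \sum_(i <- B) a i.
Proof.
move=> a0 AB; rewrite (big_fsetID _ (mem A) B)/=.
have -> : [fset i in B | mem A i]%fset = A.
  apply/fsetP => i; rewrite !inE andbC /=.
  by case: (boolP (i \in A)) => //= /(fsubsetP AB).
by rewrite lerDl sumr_ge0.
Qed.

(** The net of partial sums of a nonnegative family is monotone, so it converges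
    to its supremum. *)
Lemma cvg_nonneg_sum (a : I -> R) (M : R) : (forall i, 0 <= a i) ->
  (forall A, \sum_(i <- A) a i <= M) ->
  cvg (partial_sum (fun i => scalar_of_real (a i) : K) @ totally).
Proof.
move=> a0 aM; pose E := [set \sum_(i <- A) a i | A in [set: {fset I}]].
have supE : has_sup E.
  split; first by exists (\sum_(i <- fset0) a i), fset0.
  by exists M => _ [A _ <-].
apply/cvg_ex; exists (scalar_of_real (sup E)); apply/cvg_partial_sumP => e e0.
have [_ [A _ <-] Ae] := sup_adherent e0 supE; exists A => B AB.
have BE : \sum_(i <- B) a i <= sup E by apply: sup_upper_bound => //; exists B.
rewrite -scalar_of_real_sum -[- scalar_of_real _]mulN1r.
have -> : -1 = scalar_of_real (-1) :> K.
  by rewrite /scalar_of_real; case: c => //; rewrite rmorphN1.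
rewrite -scalar_of_realM -scalar_of_realD mulN1r modulus_scalar_of_real.
rewrite ger0_norm ?subr_ge0// lerBlDl -lerBlDr.
by rewrite (le_trans (ltW Ae))// ler_sum_fset.
Qed.

Lemma cvg_absolute_sum x (M : R) :
  (forall A, \sum_(i <- A) modulus (x i) <= M) ->
  cvg (partial_sum x @ totally).
Proof.
move=> xM; have [w [P1 [N1 [P2 [N2 D]]]]] := @scalar_decomposition R c.
have cvgpart (P : K -> R) : (forall z, 0 <= P z <= modulus z) ->
    cvg (partial_sum (fun i => scalar_of_real (P (x i)) : K) @ totally).
  move=> Pb; apply: (@cvg_nonneg_sum _ M) => [i|A].
    by have /andP[] := Pb (x i).
  by apply: le_trans (xM A); apply: ler_sum => i _; have /andP[] := Pb (x i).
have -> : x = (fun i =>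
    (scalar_of_real (P1 (x i)) + (-1) * scalar_of_real (N1 (x i))) +
    w * (scalar_of_real (P2 (x i)) + (-1) * scalar_of_real (N2 (x i)))).
  by apply/funext => i; rewrite !mulN1r; have [_ _ _ _ <-] := D (x i).
rewrite partial_sumD partial_sumZ !partial_sumD !partial_sumZ.
have cP1 := cvgpart P1 (fun z => let: And5 h _ _ _ _ := D z in h).
have cN1 := cvgpart N1 (fun z => let: And5 _ h _ _ _ := D z in h).
have cP2 := cvgpart P2 (fun z => let: And5 _ _ h _ _ := D z in h).
have cN2 := cvgpart N2 (fun z => let: And5 _ _ _ h _ := D z in h).
apply: is_cvgD; first by apply: is_cvgD => //; exact: is_cvgMl_tmp.
by apply: is_cvgMl_tmp; apply: is_cvgD => //; exact: is_cvgMl_tmp.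
Qed.

Lemma cvg_sum_lim x (l : K) :
  partial_sum x @ totally --> l -> summability.sum x = l.
Proof. by apply: cvg_lim; exact: norm_hausdorff. Qed.

Lemma modulus_sum_le x (M : R) :
  (forall A, \sum_(i <- A) modulus (x i) <= M) ->
  modulus (summability.sum x) <= M.
Proof.
move=> xM; have /cvg_partial_sumP xl := cvg_absolute_sum xM.
apply/ler_addgt0Pr => e e0; have [A /(_ A (fsubset_refl A)) Al] := xl e e0.
rewrite /summability.sum -(subrK (\sum_(i <- A) x i) (lim _)) addrC.
rewrite (le_trans (modulusD _ _))// lerD//.
exact: le_trans (modulus_sum _ _) (xM A).
Qed.

Lemma sumD x y :
  cvg (partial_sum x @ totally) -> cvg (partial_sum y @ totally) ->
  summability.sum (fun i => x i + y i) = summability.sum x + summability.sum y.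
Proof.
by move=> cx cy; apply: cvg_sum_lim; rewrite partial_sumD; exact: cvgD.
Qed.

Lemma sumZ (a : K) x : cvg (partial_sum x @ totally) ->
  summability.sum (fun i => a * x i) = a * summability.sum x.
Proof.
by move=> cx; apply: cvg_sum_lim; rewrite partial_sumZ; exact: cvgMl_tmp.
Qed.

Lemma sum_finite x (s : seq I) : uniq s -> (forall i, i \notin s -> x i = 0) ->
  summability.sum x = \sum_(i <- s) x i.
Proof.
move=> us xs; apply: cvg_sum_lim; apply/cvg_partial_sumP => e e0.
exists [fset i in s]%fset => B sB.
suff -> : \sum_(i <- B) x i = \sum_(i <- s) x i by rewrite subrr modulus0 ltW.
rewrite [LHS](bigID (mem s))/= [X in _ + X]big1 ?addr0; last first.
  by move=> i /xs.
rewrite -big_filter; apply: perm_big; apply: uniq_perm => //.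
  by rewrite filter_uniq// fset_uniq.
move=> i; rewrite mem_filter; apply/andP/idP => [[]//|is_]; split=> //.
by apply: (fsubsetP sB); rewrite !inE.
Qed.

End UnorderedSums.

(** * Finite sections of the dyadic tree *)

Section Subtree.
Implicit Types (I J : dyadic) (n : nat).

(** The recursion mirrors that of [node_norm], whose value at depth [n] below
    [I] is determined by the entries on this list. *)
Fixpoint subtree n I : seq dyadic :=
  if n is m.+1
  then I :: subtree m (dyadic_right I) ++ subtree m (dyadic_left I)
  else [:: I].

Lemma subtree_self n I : I \in subtree n I.
Proof. by case: n => [|n]; rewrite /= mem_head. Qed.

Lemma mem_subtreeS n I J : (J \in subtree n.+1 I) =
  [|| J == I, J \in subtree n (dyadic_right I) |
      J \in subtree n (dyadic_left I)].
Proof. by rewrite inE mem_cat. Qed.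

Lemma dyadic_nat_inj I J :
  tag I = tag J -> tagged I = tagged J :> nat -> I = J.
Proof. by case: I J => i k [j l] /= ij; case: _ / ij l => l /val_inj ->. Qed.

(** Dropping the last binary digits of the position of a descendant gives back
    the position of the ancestor.  Disjointness of the subtrees below the two
    children follows by parity. *)
Lemma subtree_position n I J : J \in subtree n I ->
  (tag I <= tag J <= tag I + n)%N /\
  ((tagged J : nat) %/ 2 ^ (tag J - tag I))%N = tagged I :> nat.
Proof.
have half (k i j : nat) : (i < j)%N ->
    (k %/ 2 ^ (j - i) = k %/ 2 ^ (j - i.+1) %/ 2)%N.
  by move=> ij; rewrite subnS -divnMA -expnSr prednK// subn_gt0.
elim: n I => [|n IHn] I.
  by rewrite inE => /eqP ->; rewrite addn0 leqnn subnn expn0 divn1.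
rewrite /= inE mem_cat => /predU1P[->|/orP[]/IHn/= [/andP[IJ Jn] JI]].
- by rewrite leqnn leq_addr subnn expn0 divn1.
- split; first by rewrite (ltnW IJ) addnS -addSn.
  by rewrite half// JI divn2 /= uphalf_double.
- split; first by rewrite (ltnW IJ) addnS -addSn.
  by rewrite half// JI divn2 doubleK.
Qed.

Lemma subtree_right_left n I J :
  J \in subtree n (dyadic_right I) -> J \notin subtree n (dyadic_left I).
Proof.
move=> /subtree_position[_ /= r]; apply/negP => /subtree_position[_ /= l].
by move: r; rewrite l => /(congr1 odd); rewrite /= !odd_double.
Qed.

Lemma root_notin_right n I : I \notin subtree n (dyadic_right I).
Proof. by apply/negP => /subtree_position[/andP[/=]]; rewrite ltnn. Qed.

Lemma root_notin_left n I : I \notin subtree n (dyadic_left I).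
Proof. by apply/negP => /subtree_position[/andP[/=]]; rewrite ltnn. Qed.

Lemma subtree_uniq n I : uniq (subtree n I).
Proof.
elim: n I => [|n IHn] I //=; rewrite cat_uniq !IHn mem_cat negb_or.
rewrite root_notin_right root_notin_left /= andbT.
apply/hasPn => J; apply: contraL; exact: subtree_right_left.
Qed.

Lemma subtree_leq m n I : (m <= n)%N -> {subset subtree m I <= subtree n I}.
Proof.
elim: m n I => [|m IHm] n I mn J.
  by rewrite inE => /eqP ->; exact: subtree_self.
case: n mn => // n mn; rewrite !mem_subtreeS.
by move=> /or3P[->|/(IHm _ _ mn) ->|/(IHm _ _ mn) ->]; rewrite ?orbT.
Qed.

Lemma subtree_child n I J : J \in subtree n I ->
  (dyadic_right J \in subtree n.+1 I) && (dyadic_left J \in subtree n.+1 I).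
Proof.
elim: n I => [|n IHn] I.
  by rewrite inE => /eqP ->; rewrite !mem_subtreeS !subtree_self !orbT.
rewrite mem_subtreeS => /or3P[/eqP ->|/IHn/andP[r l]|/IHn/andP[r l]].
- by rewrite !(mem_subtreeS n.+1) !subtree_self !orbT.
- by rewrite !(mem_subtreeS n.+1) r l !orbT.
- by rewrite !(mem_subtreeS n.+1) r l !orbT.
Qed.

(** Each interval is the left or right half of the one obtained by halving its
    position, so every interval is reached from the root. *)
Lemma mem_subtree_root n J : (J \in subtree n dyadic_root) = (tag J <= n)%N.
Proof.
apply/idP/idP => [/subtree_position[/andP[]]//|].
move=> Jn; apply: (subtree_leq Jn).
elim: (tag J) {-2}J (erefl (tag J)) {n Jn} => {J} [|j IHj] J tJ.
  rewrite tJ mem_seq1; apply/eqP; apply: dyadic_nat_inj => //=.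
  by case: J tJ => [i [k ki]] /= i0; move: ki; rewrite i0 ltnS leqn0 => /eqP.
have kj : ((tagged J)./2 < 2 ^ j)%N.
  rewrite -ltn_double -[(2 ^ j).*2]mul2n -expnS -tJ.
  apply: leq_ltn_trans (ltn_ord (tagged J)).
  by rewrite -[leqRHS]odd_double_half leq_addl.
rewrite tJ; have /andP[r l] := subtree_child (IHj (mk_dyadic kj) erefl).
have kE := odd_double_half (tagged J).
case o : (odd (tagged J)) kE => kE.
  suff -> : J = dyadic_right (mk_dyadic kj) by [].
  by apply: dyadic_nat_inj => //=; rewrite -kE.
suff -> : J = dyadic_left (mk_dyadic kj) by [].
by apply: dyadic_nat_inj => //=; rewrite -[LHS]kE.
Qed.

End Subtree.

(** * Duality for the node norms *)

Section NodeNorm.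
Context {R : realType} {c : scalars}.
Local Notation K := (scalar_field R c).
Implicit Types (p q : \bar R) (f g : dyadic -> K) (I J : dyadic) (n : nat).

Lemma node_norm_ge0 p q f n I : 0 <= node_norm p q f n I.
Proof. by elim: n I => [|n IHn] I /=; rewrite ?modulus_ge0// !lpair_ge0. Qed.

Lemma eq_node_norm p q f g n I : {in subtree n I, f =1 g} ->
  node_norm p q f n I = node_norm p q g n I.
Proof.
elim: n I => [|n IHn] I fg /=; first by rewrite fg ?subtree_self.
rewrite fg ?subtree_self// (IHn (dyadic_right I)) ?(IHn (dyadic_left I))//.
  by move=> J JI; apply: fg; rewrite mem_subtreeS JI !orbT.
by move=> J JI; apply: fg; rewrite mem_subtreeS JI !orbT.
Qed.

Lemma node_normZ p q (a : K) f n I : (1 <= p)%E -> (1 <= q)%E ->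
  node_norm p q (fun J => a * f J) n I = modulus a * node_norm p q f n I.
Proof.
move=> p1 q1; elim: n I => [|n IHn] I /=; first by rewrite modulusM.
by rewrite !IHn modulusM !lpairZ ?lpair_ge0 ?node_norm_ge0 ?modulus_ge0.
Qed.

Lemma node_norm_leq p q f m n I : (1 <= p)%E -> (1 <= q)%E -> (m <= n)%N ->
  node_norm p q f m I <= node_norm p q f n I.
Proof.
move=> p1 q1; elim: m n I => [|m IHm] [|n] I //= mn; last first.
  by apply: lpair_le; rewrite ?lpair_ge0 ?node_norm_ge0 ?modulus_ge0//;
    apply: lpair_le; rewrite ?node_norm_ge0 ?IHm.
rewrite -[leLHS](lpair0l q1) ?modulus_ge0//.
by apply: lpair_le; rewrite ?modulus_ge0 ?lpair_ge0 ?node_norm_ge0.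
Qed.

Lemma node_norm_support p q f n I : (1 <= p)%E -> (1 <= q)%E ->
  (forall J, (tag I + n < tag J)%N -> f J = 0) ->
  node_norm p q f n.+1 I = node_norm p q f n I.
Proof.
move=> p1 q1; elim: n I => [|n IHn] I fI.
  rewrite /= (fI (dyadic_right I)) ?addn0// (fI (dyadic_left I)) ?addn0//.
  by rewrite modulus0 !lpair0l ?modulus_ge0.
have E C : tag C = (tag I).+1 -> node_norm p q f n.+1 C = node_norm p q f n C.
  by move=> tC; apply: IHn => J; rewrite tC addSn -addnS; exact: fI.
have NS m : node_norm p q f m.+1 I = lpair q
    (lpair p (node_norm p q f m (dyadic_right I))
             (node_norm p q f m (dyadic_left I))) (modulus (f I)) by [].
by rewrite NS E// E// -NS.
Qed.

(** Hoelder's inequality for p at the children of a node, whose sections satisfy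
    the inequality by induction, then for q at the node itself. *)
Lemma node_norm_hoelder p q p' q' f g n I :
  conjugate_exponents p p' -> conjugate_exponents q q' ->
  \sum_(J <- subtree n I) modulus (f J * g J) <=
    node_norm p q f n I * node_norm p' q' g n I.
Proof.
move=> pp' qq'; elim: n I => [|n IHn] I.
  by rewrite big_seq1 modulusM.
rewrite /= big_cons big_cat /= modulusM [leLHS]addrC.
have hp := lpair_hoelder pp' (node_norm_ge0 p q f n (dyadic_right I))
  (node_norm_ge0 p q f n (dyadic_left I))
  (node_norm_ge0 p' q' g n (dyadic_right I))
  (node_norm_ge0 p' q' g n (dyadic_left I)).
have ge0 r s (h : dyadic -> K) :
  0 <= lpair r (node_norm r s h n (dyadic_right I))
    (node_norm r s h n (dyadic_left I)) by rewrite lpair_ge0// node_norm_ge0.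
have hq := lpair_hoelder qq' (ge0 p q f) (modulus_ge0 (f I))
  (ge0 p' q' g) (modulus_ge0 (g I)).
apply: le_trans hq; rewrite lerD2r; apply: le_trans hp; exact: lerD.
Qed.

(** The norming sequence is glued from the norming sequences of the two
    children.  The pair ([x], [y]) norms the pair of their dual norms, and
    ([a], [b]) norms the pair made of the resulting l^p' norm and of |g_I|; the
    children thus receive the weights [a * x] and [a * y], and the node the
    weight [b] times a phase. *)
Lemma node_norm_dual_attained p q p' q' g n I :
  conjugate_exponents p p' -> conjugate_exponents q q' ->
  exists f, [/\ node_norm p q f n I <= 1,
    forall J, J \notin subtree n I -> f J = 0 &
    \sum_(J <- subtree n I) f J * g J =
      scalar_of_real (node_norm p' q' g n I)].
Proof.
move=> pp' qq'.
have p1 := conjugate_exponents_ge1 pp'; have q1 := conjugate_exponents_ge1 qq'.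
elim: n I => [|n IHn] I; have [u u1 ug] := exists_phase (g I).
  exists (fun J => if J == I then u else 0); split.
  - by rewrite /= eqxx.
  - by move=> J; rewrite mem_seq1 => /negbTE ->.
  - by rewrite big_seq1 eqxx.
have [fr [fr1 fr0 frg]] := IHn (dyadic_right I).
have [fl [fl1 fl0 flg]] := IHn (dyadic_left I).
set Nr := node_norm p' q' g n (dyadic_right I) in frg *.
set Nl := node_norm p' q' g n (dyadic_left I) in flg *.
have Nr0 : 0 <= Nr by exact: node_norm_ge0.
have Nl0 : 0 <= Nl by exact: node_norm_ge0.
have [x [y [x0 y0 xy1 xyE]]] := lpair_dual_attained pp' Nr0 Nl0.
have N0 : 0 <= lpair p' Nr Nl by rewrite lpair_ge0.
have [a [b [a0 b0 ab1 abE]]] := lpair_dual_attained qq' N0 (modulus_ge0 (g I)).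
pose f J := (if J == I then scalar_of_real b * u else 0)
  + scalar_of_real (a * x) * fr J + scalar_of_real (a * y) * fl J.
have fI : f I = scalar_of_real b * u.
  rewrite /f eqxx fr0 ?root_notin_right// fl0 ?root_notin_left//.
  by rewrite !mulr0 !addr0.
have f_right : {in subtree n (dyadic_right I),
    f =1 fun J => scalar_of_real (a * x) * fr J}.
  move=> J JI; rewrite /f (fl0 J) ?subtree_right_left// mulr0 addr0.
  case: eqP => [JE|_]; rewrite ?add0r//.
  by move: (root_notin_right n I); rewrite -{1}JE JI.
have f_left : {in subtree n (dyadic_left I),
    f =1 fun J => scalar_of_real (a * y) * fl J}.
  move=> J JI; rewrite /f (fr0 J) ?mulr0 ?addr0; last first.
    by apply: contraL JI; exact: subtree_right_left.
  case: eqP => [JE|_]; rewrite ?add0r//.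
  by move: (root_notin_left n I); rewrite -{1}JE JI.
exists f; split.
- apply: le_trans ab1; rewrite /= (eq_node_norm _ _ f_right).
  rewrite (eq_node_norm _ _ f_left) !node_normZ// fI modulusM.
  rewrite !modulus_scalar_of_real !ger0_norm ?mulr_ge0//.
  apply: lpair_le => //.
  + by rewrite lpair_ge0// !mulr_ge0// node_norm_ge0.
  + by rewrite mulr_ge0// modulus_ge0.
  + rewrite -[leRHS]mulr1; apply: le_trans (ler_wpM2l a0 xy1).
    rewrite -lpairZ//; apply: lpair_le; rewrite ?mulr_ge0 ?node_norm_ge0//.
      by rewrite ler_piMr// mulr_ge0.
    by rewrite ler_piMr// mulr_ge0.
  + by rewrite ler_piMr.
- move=> J; rewrite mem_subtreeS !negb_or => /and3P[/negbTE JI Jr Jl].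
  by rewrite /f JI (fr0 _ Jr) (fl0 _ Jl) !mulr0 !addr0.
- rewrite /= big_cons big_cat /= fI -mulrA ug -scalar_of_realM.
  rewrite (eq_big_seq (fun J => scalar_of_real (a * x) * (fr J * g J))); last first.
    by move=> J /f_right ->; rewrite mulrA.
  rewrite [X in _ + (_ + X)](eq_big_seq
    (fun J => scalar_of_real (a * y) * (fl J * g J))); last first.
    by move=> J /f_left ->; rewrite mulrA.
  rewrite -!mulr_sumr frg flg -!scalar_of_realM -!scalar_of_realD.
  by rewrite -abE -xyE -!mulrA -mulrDr addrC.
Qed.

End NodeNorm.

(** * The pairing of X^{p,q} with X^{p',q'} *)

Section Duality.
Context {R : realType} {c : scalars}.
Local Notation K := (scalar_field R c).
Context (p q p' q' : \bar R).
Context (pp' : conjugate_exponents p p') (qq' : conjugate_exponents q q').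
Implicit Types (r s : \bar R) (f g h : dyadic -> K) (I J : dyadic) (n : nat).

Let p1 : (1 <= p)%E := conjugate_exponents_ge1 pp'.
Let q1 : (1 <= q)%E := conjugate_exponents_ge1 qq'.

Lemma node_norm_truncation r s f n :
  node_norm r s (truncation n f) n dyadic_root = node_norm r s f n dyadic_root.
Proof.
by apply: eq_node_norm => J; rewrite mem_subtree_root /truncation => ->.
Qed.

Lemma node_norm_Xnorm r s f n :
  ((node_norm r s f n dyadic_root)%:E <= Xnorm r s f)%E.
Proof.
by apply: ereal_sup_ubound; exists n => //; rewrite node_norm_truncation.
Qed.

Lemma Xnorm_le r s f (M : \bar R) :
  (forall n, ((node_norm r s f n dyadic_root)%:E <= M)%E) ->
  (Xnorm r s f <= M)%E.
Proof.
by move=> fM; apply: ge_ereal_sup => _ [n _ <-]; rewrite node_norm_truncation.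
Qed.

Lemma Xnorm_ge0 r s f : (0 <= Xnorm r s f)%E.
Proof.
by apply: le_trans (node_norm_Xnorm r s f 0); rewrite lee_fin node_norm_ge0.
Qed.

Lemma Xnorm_fineK r s f : Xspace r s f -> (fine (Xnorm r s f))%:E = Xnorm r s f.
Proof. by move=> fX; rewrite fineK// ge0_fin_numE ?Xnorm_ge0. Qed.

Definition supported_to n f := forall J, (n < tag J)%N -> f J = 0.

Lemma Xnorm_supported f n : supported_to n f ->
  (Xnorm p q f <= (node_norm p q f n dyadic_root)%:E)%E.
Proof.
move=> fn; apply: Xnorm_le => m; rewrite lee_fin.
have stable k :
    node_norm p q f (n + k) dyadic_root = node_norm p q f n dyadic_root.
  elim: k => [|k <-]; rewrite ?addn0// addnS node_norm_support// => J /=.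
  by rewrite add0n => /(leq_ltn_trans (leq_addr _ _)); exact: fn.
by rewrite -(stable m) node_norm_leq// leq_addl.
Qed.

Lemma supported_toP f : Defs.finite_support f <-> exists n, supported_to n f.
Proof.
split=> [/finite_seqP[s fs]|[n fn]].
  exists (\max_(J <- s) tag J) => J; rewrite ltnNge; apply: contraNeq => fJ.
  have Js : J \in s by have : [set` s] J by rewrite -fs.
  by rewrite leq_bigmax_seq.
apply: (@sub_finite_set _ _ [set` subtree n dyadic_root]) => [J /=|].
  by rewrite mem_subtree_root; apply: contraNT; rewrite -ltnNge => /fn ->.
by apply/finite_seqP; exists (subtree n dyadic_root).
Qed.

Lemma Xspace_supported f n : supported_to n f -> Xspace p q f.
Proof.
by move=> fn; apply: le_lt_trans (Xnorm_supported fn) _; rewrite ltry.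
Qed.

Lemma Xnorm_zero : Xnorm p q (0 : dyadic -> K) = 0%E.
Proof.
have s0 : supported_to 0 (0 : dyadic -> K) by [].
apply/le_anti; rewrite Xnorm_ge0 andbT (le_trans (Xnorm_supported s0))//.
by rewrite /= modulus0.
Qed.

Lemma X0space_supported f n : supported_to n f -> X0space p q f.
Proof.
move=> fn; split=> [|e e0]; first exact: Xspace_supported fn.
exists f; first by apply/supported_toP; exists n.
by rewrite subrr Xnorm_zero lte_fin.
Qed.

Lemma sum_modulus_le f g (A : {fset dyadic}) : Xspace p q f -> Xspace p' q' g ->
  \sum_(J <- A) modulus (f J * g J) <=
    fine (Xnorm p q f) * fine (Xnorm p' q' g).
Proof.
move=> fX gX; pose n := (\max_(J <- A) tag J)%N.
apply: (@le_trans _ _ (\sum_(J <- subtree n dyadic_root) modulus (f J * g J))).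
  have AS : (A `<=` [fset J in subtree n dyadic_root])%fset.
    apply/fsubsetP => J JA; rewrite !inE mem_subtree_root.
    by rewrite leq_bigmax_seq.
  apply: le_trans (ler_sum_fset (fun J => modulus_ge0 (f J * g J)) AS) _.
  rewrite le_eqVlt; apply/predU1P; left; apply: perm_big; apply: uniq_perm.
  - exact: fset_uniq.
  - exact: subtree_uniq.
  - by move=> J; rewrite !inE.
apply: le_trans (node_norm_hoelder f g n dyadic_root pp' qq') _.
apply: ler_pM; rewrite ?node_norm_ge0//.
  by rewrite -lee_fin Xnorm_fineK// node_norm_Xnorm.
by rewrite -lee_fin Xnorm_fineK// node_norm_Xnorm.
Qed.

Lemma pairing_cvg_Xspace f g : Xspace p q f -> Xspace p' q' g -> pairing_cvg f g.
Proof. by move=> fX gX; apply: cvg_absolute_sum => A; exact: sum_modulus_le. Qed.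

Lemma modulus_pairing_le f g : Xspace p q f -> Xspace p' q' g ->
  modulus (pairing f g) <= fine (Xnorm p q f) * fine (Xnorm p' q' g).
Proof. by move=> fX gX; apply: modulus_sum_le => A; exact: sum_modulus_le. Qed.

Lemma pairing_linear (a : K) f h g :
  Xspace p q f -> Xspace p q h -> Xspace p' q' g ->
  pairing (a *: f + h) g = a * pairing f g + pairing h g.
Proof.
move=> fX hX gX; have cf := pairing_cvg_Xspace fX gX.
have ch := pairing_cvg_Xspace hX gX.
have ca : cvg (partial_sum (fun J => a * (f J * g J)) @ totally).
  by rewrite partial_sumZ; exact: is_cvgMl_tmp.
rewrite /pairing -(sumZ a cf) -(sumD ca ch).
by congr summability.sum; apply/funext => J; rewrite mulrA -mulrDl.
Qed.

Lemma pairing_supported f g n : supported_to n f ->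
  pairing f g = \sum_(J <- subtree n dyadic_root) f J * g J.
Proof.
move=> fn; apply: sum_finite; first exact: subtree_uniq.
by move=> J; rewrite mem_subtree_root -ltnNge => /fn ->; rewrite mul0r.
Qed.

Lemma exists_norming g n : exists f, [/\ supported_to n f,
  (Xnorm p q f <= 1)%E &
  pairing f g = scalar_of_real (node_norm p' q' g n dyadic_root)].
Proof.
have [f [f1 f0 fg]] := node_norm_dual_attained g n dyadic_root pp' qq'.
have fn : supported_to n f.
  by move=> J nJ; apply: f0; rewrite mem_subtree_root -ltnNge.
exists f; split=> //; last by rewrite (pairing_supported _ fn).
by apply: le_trans (Xnorm_supported fn) _; rewrite lee_fin.
Qed.

Lemma bounded_pairing g : Xspace p' q' g ->
  bounded_functional p q (fun f => pairing f g).
Proof.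
move=> gX; split=> [a f h [fX _] [hX _]|]; first exact: pairing_linear.
exists (fine (Xnorm p' q' g)) => f [fX _].
by rewrite -(Xnorm_fineK fX) -EFinM lee_fin mulrC modulus_pairing_le.
Qed.

(** The upper bound is the duality inequality.  For the lower bound, each
    section of g is normed by a finitely supported sequence of the unit ball, on which
    the pairing takes the value of the node norm of that section. *)
Lemma functional_norm_pairing g : Xspace p' q' g ->
  functional_norm p q (fun f => pairing f g) = Xnorm p' q' g.
Proof.
move=> gX; apply/le_anti/andP; split.
  apply: ge_ereal_sup => _ [f [[fX _] f1] <-].
  rewrite -(Xnorm_fineK gX) lee_fin (le_trans (modulus_pairing_le fX gX))//.
  rewrite ler_piMl ?fine_ge0 ?Xnorm_ge0//.
  by rewrite -lee_fin Xnorm_fineK.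
apply: Xnorm_le => n; have [f [fn f1 fg]] := exists_norming g n.
apply: ereal_sup_ubound; exists f.
  by split=> //; exact: X0space_supported fn.
by rewrite fg modulus_scalar_of_real ger0_norm// node_norm_ge0.
Qed.

Definition unit_sequence I : dyadic -> K := fun J => (J == I)%:R.

Lemma unit_sequence_supported I : supported_to (tag I) (unit_sequence I).
Proof.
by move=> J; rewrite /unit_sequence; case: eqP => // ->; rewrite ltnn.
Qed.

Lemma pairing_unit_sequence I g : pairing (unit_sequence I) g = g I.
Proof.
rewrite /pairing (@sum_finite _ _ _ _ [:: I])//; last first.
  by move=> J; rewrite mem_seq1 /unit_sequence => /negbTE ->; rewrite mul0r.
by rewrite big_seq1 /unit_sequence eqxx mul1r.
Qed.

(** * Representation of the bounded functionals *)

Section Representation.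
Context (phi : (dyadic -> K) -> K).
Context (phi_bounded : bounded_functional p q phi).

Let g I := phi (unit_sequence I).

Lemma functional_zero : phi 0 = 0.
Proof.
have z : X0space p q (0 : dyadic -> K) by exact: (@X0space_supported _ 0).
have := phi_bounded.1 1 0 0 z z; rewrite scaler0 addr0 mul1r.
by move=> /eqP; rewrite -[X in X == _]addr0 (inj_eq (addrI _)) eq_sym => /eqP.
Qed.

Lemma functional_supported f n : supported_to n f -> phi f = pairing f g.
Proof.
move=> fn; rewrite (pairing_supported _ fn).
have uE J L : (f J *: unit_sequence J) L = f J * (L == J)%:R by [].
have fE : f = \sum_(J <- subtree n dyadic_root) f J *: unit_sequence J.
  apply/funext => I; rewrite fct_sumE.
  have [In|In] := leqP (tag I) n.
    rewrite (bigD1_seq I) ?mem_subtree_root ?subtree_uniq//=.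
    rewrite uE eqxx mulr1 big1 ?addr0// => J JI.
    by rewrite uE eq_sym (negbTE JI) mulr0.
  rewrite fn// big_seq big1// => J; rewrite mem_subtree_root => Jn.
  rewrite uE; case: eqP => [IJ|]; rewrite ?mulr0//.
  by move: In; rewrite IJ ltnNge Jn.
rewrite {1}fE.
have : all (fun J => (tag J <= n)%N) (subtree n dyadic_root).
  by apply/allP => J; rewrite mem_subtree_root.
(* Linearity is available only on the closed subspace; the partial sums stay
   in it because they are supported on the levels up to [n]. *)
elim: (subtree n dyadic_root) => [|J s IHs].
  by rewrite !big_nil functional_zero.
rewrite /= => /andP[Jn sn]; rewrite !big_cons.
have sX : supported_to n (\sum_(I <- s) f I *: unit_sequence I).
  move=> I nI; rewrite fct_sumE big_seq big1// => L Ls.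
  rewrite uE; case: eqP => [IL|]; rewrite ?mulr0//.
  by move: nI; rewrite IL ltnNge (allP sn).
rewrite phi_bounded.1 ?IHs//; last exact: X0space_supported sX.
exact: X0space_supported (@unit_sequence_supported J).
Qed.

Lemma functional_bound : exists2 M : R, 0 <= M & forall f, X0space p q f ->
  modulus (phi f) <= M * fine (Xnorm p q f).
Proof.
have [_ [M bM]] := phi_bounded; exists (Num.max M 0) => [|f fX].
  by rewrite le_max lexx orbT.
have := bM f fX; rewrite -(Xnorm_fineK fX.1) -EFinM lee_fin => /le_trans; apply.
by rewrite ler_wpM2r ?fine_ge0 ?Xnorm_ge0// le_max lexx.
Qed.

(** The norming sequence of the n-th section of g has norm at most 1 and phi
    takes on it the value of the node norm of the section, so this node norm is
    bounded by the norm of phi. *)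
Lemma representing_Xspace : Xspace p' q' g.
Proof.
have [M M0 bM] := functional_bound.
apply: (@le_lt_trans _ _ M%:E); last exact: ltry.
apply: Xnorm_le => n; have [f [fn f1 fg]] := exists_norming g n.
have fX := X0space_supported fn.
have := bM f fX; rewrite (functional_supported fn) fg modulus_scalar_of_real.
rewrite ger0_norm ?node_norm_ge0// => /le_trans; rewrite lee_fin; apply.
by rewrite ler_piMr// -lee_fin Xnorm_fineK//; have [] := fX.
Qed.

(** Density: if h has finite support then phi f - <f, g> = phi (f - h) -
    <f - h, g>, whose modulus is at most (M + N) times the norm of f - h, for M
    a bound of phi and N the norm of g. *)
Lemma functional_pairing f : X0space p q f -> phi f = pairing f g.
Proof.
move=> fX0; have [fX fapp] := fX0; have [M M0 bM] := functional_bound.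
have gX := representing_Xspace; set N := fine (Xnorm p' q' g).
have N0 : 0 <= N by rewrite fine_ge0 ?Xnorm_ge0.
apply/eqP; rewrite -subr_eq0; apply/eqP/modulus_eq0/le_anti.
rewrite modulus_ge0 andbT; apply/ler_addgt0Pl => e e0; rewrite addr0.
have MN0 : 0 < M + N + 1 by rewrite ltr_wpDl ?addr_ge0.
(* Adding 1 to [M + N] makes the divisor positive. *)
have [h hfin fh] := fapp _ (divr_gt0 e0 MN0).
have [n hn] := (supported_toP _).1 hfin.
have hX0 := X0space_supported hn.
have fhX : X0space p q (f - h).
  (* If h' approximates f then h' - h approximates f - h with the same error. *)
  split=> [|d d0]; first by apply: lt_trans fh _; exact: ltry.
  have [h' h'fin fh'] := fapp d d0; exists (h' - h); last first.
    by rewrite opprB addrA subrK.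
  have [m h'm] := (supported_toP _).1 h'fin.
  apply/supported_toP; exists (maxn m n) => J; rewrite gtn_max => /andP[mJ nJ].
  by rewrite !fctE h'm// hn// subr0.
have fE : f = 1 *: (f - h) + h by rewrite scale1r subrK.
have -> : phi f - pairing f g = phi (f - h) - pairing (f - h) g.
  have := phi_bounded.1 1 _ _ fhX hX0.
  have := pairing_linear 1 fhX.1 hX0.1 gX.
  rewrite -fE !mul1r => -> ->.
  by rewrite (functional_supported hn) [X in _ - X]addrC addrKA.
have fhe : fine (Xnorm p q (f - h)) <= e / (M + N + 1).
  by rewrite -lee_fin (Xnorm_fineK fhX.1) ltW.
apply: le_trans (modulusD _ _) _; rewrite modulusN.
have := lerD (bM _ fhX) (modulus_pairing_le fhX.1 gX).
move=> /le_trans; apply; rewrite -/N mulrC -mulrDr.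
apply: (@le_trans _ _ (e / (M + N + 1) * (M + N))).
  by rewrite ler_wpM2r// addr_ge0.
by rewrite mulrAC ler_pdivrMr// (ler_wpM2l (ltW e0))// lerDl.
Qed.

End Representation.

End Duality.

Theorem theorem3p1 (R : realType) (c : scalars) (p q p' q' : \bar R)
    (p_ge1 : (1 <= p)%E) (q_ge1 : (1 <= q)%E)
    (pp' : (p^-1 + p'^-1 = 1)%E) (qq' : (q^-1 + q'^-1 = 1)%E) :
  (forall g : dyadic -> scalar_field R c, Xspace p' q' g ->
     [/\ forall f, X0space p q f -> pairing_cvg f g,
         bounded_functional p q (fun f => pairing f g)
       & functional_norm p q (fun f => pairing f g) = Xnorm p' q' g]) /\
  (forall phi : (dyadic -> scalar_field R c) -> scalar_field R c,
     bounded_functional p q phi ->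
     exists! g : dyadic -> scalar_field R c,
       Xspace p' q' g /\ (forall f, X0space p q f -> phi f = pairing f g)).
Proof.
have cp := conjugate_exponentsP p_ge1 pp'.
have cq := conjugate_exponentsP q_ge1 qq'.
split=> [g gX|phi phi_bounded].
  split=> [f [fX _]||].
  - exact: (pairing_cvg_Xspace cp cq).
  - exact: (bounded_pairing cp cq).
  - exact: (functional_norm_pairing cp cq).
exists (fun I => phi (unit_sequence I)); split=> [|g [gX phig]].
  split=> [|f fX0]; first exact: (representing_Xspace cp cq).
  exact: (functional_pairing cp cq).
apply/funext => I; rewrite phig ?pairing_unit_sequence//.
exact: (X0space_supported cp cq (@unit_sequence_supported _ _ I)).
Qed.
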